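(* Let $P(s)=\dfrac{s-z}{(s-p_1)(s-p_2)}$ with $z>0$, $\operatorname{Re}(p_1)>0$, $\operatorname{Re}(p_2)>0$, where $p_1,p_2$ are either both real or a complex conjugate pair. For some PI controller to stabilize $P$, it is necessary that $p_1+p_2<p_1p_2/z$. Under this condition the following hold. (i) $$k_M^{PI}=k_M^{P}=\frac{p_1p_2}{z(p_1+p_2)}.$$ (ii) $$\theta_M^{PI}=\theta_M^{P}=\bar\theta(\omega_0),$$ where $$\bar\theta(\omega)=\tan^{-1}\frac{\omega}{z}-\tan^{-1}\frac{(p_1+p_2)\omega}{p_1p_2-\omega^2},$$ $$\omega_0=\left\{\frac{z(p_1+p_2)}{2(p_1+p_2-z)}\left(\frac{p_1^2+p_2^2}{p_1+p_2}-z-\frac{p_1p_2}{z}+\left(\Big(z-\frac{p_1p_2}{z}\Big)^2+(p_1-p_2)^2\Big(1-2\,\frac{z+p_1p_2/z}{p_1+p_2}\Big)\right)^{1/2}\right)\right\}^{1/2}.$$ The optimal PI coefficients (attaining the maximal phase margin) are $k_i^*=0$ and $$k_p^*=\sqrt{\frac{p_1+p_2}{z}\,(\omega_0^2+p_1p_2)}.$$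
   Context: Controllers: $K_P(s)=k_p$; $K_{PI}(s)=k_p+k_i/s$, with real coefficients (possibly zero). Stabilization (unity negative feedback): write the plant as $P=N_P/D_P$ with numerator and denominator polynomials exactly as displayed (no cancellation of common factors is performed) and a controller as $K=N_K/D_K$ with $N_K,D_K$ coprime real polynomials. For a nonzero complex number $c$, $K$ stabilizes $cP$ if $\deg(N_PN_K)\le\deg(D_PD_K)$ and the closed-loop characteristic polynomial $D_PD_K+cN_PN_K$ has degree $\deg(D_PD_K)$ and all its roots in the open left half-plane. Margins: for a controller type $X\in\{P,PI\}$, $k_M^{X}=\sup\{\mu:\ \exists K \text{ of type } X \text{ stabilizing } \alpha P \text{ for all }\alpha\in[1,\mu)\}$ and $\theta_M^{X}=\sup\{\eta\in[0,\pi]:\ \exists K\text{ of type }X\text{ stabilizing } e^{-j\theta}P\text{ for all }\theta\in(-\eta,\eta)\}$, where $j=\sqrt{-1}$; one and the same controller must work for the whole range of $\alpha$ (resp. $\theta$). PI coefficients $(k_p^*,k_i^* )$ are optimal for the phase margin if $k_p^*+k_i^*/s$ stabilizes $e^{-j\theta}P$ for all $|\theta|<\theta_M^{PI}$. $\tan^{-1}$ takes principal values in $[-\pi/2,\pi/2]$.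
   Formalization: When z = p_1+p_2, which the hypotheses allow, the displayed formula for ω_0 reads 0/0; in that case ω_0 is taken to be its limit value √((p_1p_2 − z²)/3), and otherwise the displayed formula is used as it stands. *)

(* Defs.v *)
From HB Require Import structures.
From mathcomp Require Import all_boot all_order all_algebra.
From mathcomp Require Import complex.
From mathcomp Require Import all_classical all_reals all_analysis.
Set Implicit Arguments.
Unset Strict Implicit.
Unset Printing Implicit Defensive.
Import Order.TTheory GRing.Theory Num.Theory.
Local Open Scope classical_set_scope.
Local Open Scope ring_scope.

Section Feedback.
Variable R : realType.
Local Notation "x %:F" := (FracField.tofrac x) : ring_scope.

(* Controllers are real rational functions, whereas a plant is a pair
   (numerator, denominator), because common factors of a plant are kept. *)

Definition p_controller (kp : R) : {fraction {poly R}} := kp%:P%:F.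

Definition pi_controller (kp ki : R) : {fraction {poly R}} :=
  kp%:P%:F + ki%:P%:F / 'X%:F.

Definition p_type : set {fraction {poly R}} :=
  [set p_controller kp | kp in [set: R]].

Definition pi_type : set {fraction {poly R}} :=
  [set K | exists kp ki : R, K = pi_controller kp ki].

Definition plant_pair : Type := ({poly R[i]} * {poly R[i]})%type.

(* [K] stabilizes [c P], for [c] nonzero.  The coprime representation [N / D]
   of [K] is unique up to a nonzero constant factor, so the existential
   quantifier over it is not a choice.  [size] is the degree plus one and
   [size 0 = 0], so the zero polynomial has the smallest degree. *)
Definition stabilizes (c : R[i]) (P : plant_pair) (K : {fraction {poly R}})
    : Prop :=
  exists N D : {poly R},
    [/\ D != 0, coprimep N D, K = N%:F / D%:F &
      let NK := map_poly (real_complex R) N in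
      let DK := map_poly (real_complex R) D in
      let chi := P.2 * DK + c *: (P.1 * NK) in
      [/\ (size (P.1 * NK)%R <= size (P.2 * DK)%R)%N,
          size chi = size (P.2 * DK) &
          forall s : R[i], root chi s -> complex.Re s < 0]].

Definition gain_margin (P : plant_pair) (X : set {fraction {poly R}})
    : \bar R :=
  ereal_sup [set mu%:E | mu in [set mu : R | exists2 K, X K &
    forall alpha : R, 1 <= alpha < mu ->
      stabilizes (real_complex R alpha) P K]].

(* exp (- j theta) *)
Definition phase_rotation (theta : R) : R[i] :=
  Complex (cos theta) (- sin theta).

(* The set contains 0 and is bounded by pi, so [sup] is its least upper
   bound. *)
Definition phase_margin (P : plant_pair) (X : set {fraction {poly R}}) : R :=
  sup [set eta : R | 0 <= eta <= pi /\ exists2 K, X K &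
    forall theta : R, - eta < theta < eta ->
      stabilizes (phase_rotation theta) P K].

Definition phase_optimal_pi (P : plant_pair) (kp ki : R) : Prop :=
  forall theta : R, `|theta| < phase_margin P pi_type ->
    stabilizes (phase_rotation theta) P (pi_controller kp ki).

(* (s - z) / ((s - p1) (s - p2)) *)
Definition plant (z : R) (p1 p2 : R[i]) : plant_pair :=
  ('X - (real_complex R z)%:P, ('X - p1%:P) * ('X - p2%:P)).

(* The formulas involve [p1] and [p2] only through the symmetric expressions
   p1 + p2, p1 p2, p1^2 + p2^2 and (p1 - p2)^2, which are real for a real or
   complex conjugate pair; [complex.Re] only transports them to [R]. *)
Definition pole_sum (p1 p2 : R[i]) : R := complex.Re (p1 + p2).
Definition pole_prod (p1 p2 : R[i]) : R := complex.Re (p1 * p2).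
Definition pole_sqsum (p1 p2 : R[i]) : R := complex.Re (p1 ^+ 2 + p2 ^+ 2).
Definition pole_sqdiff (p1 p2 : R[i]) : R := complex.Re ((p1 - p2) ^+ 2).

(* Principal value in [-pi/2, pi/2] of the inverse tangent of a / b, where a
   zero denominator gives +pi/2 or -pi/2 according to the sign of a. *)
Definition atan_quot (a b : R) : R :=
  if b == 0 then Num.sg a * (pi / 2) else atan (a / b).

Definition theta_bar (z : R) (p1 p2 : R[i]) (omega : R) : R :=
  atan (omega / z)
  - atan_quot (pole_sum p1 p2 * omega) (pole_prod p1 p2 - omega ^+ 2).

(* The closed formula reads 0 / 0 when z = p1 + p2.  The singularity is
   removable: omega0 ^ 2 is the root
   (- b + sqrt (b ^ 2 - 4 a c)) / (2 a) of a x ^ 2 + b x + c, where, for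
   S = p1 + p2 and Q = p1 p2,
     a = S - z,  b = S Q + S z ^ 2 + 2 z Q - z S ^ 2,  c = Q z (S z - Q);
   when S = z, a = 0 and b = 3 z Q > 0, the limit is - c / b, that is
   (Q - z ^ 2) / 3. *)
Definition omega0 (z : R) (p1 p2 : R[i]) : R :=
  let S := pole_sum p1 p2 in
  let Q := pole_prod p1 p2 in
  if S == z then Num.sqrt ((Q - z ^+ 2) / 3)
  else Num.sqrt
    (z * S / (2 * (S - z)) *
     (pole_sqsum p1 p2 / S - z - Q / z +
      Num.sqrt ((z - Q / z) ^+ 2 +
                pole_sqdiff p1 p2 * (1 - 2 * ((z + Q / z) / S))))).

Definition kp_opt (z : R) (p1 p2 : R[i]) : R :=
  Num.sqrt (pole_sum p1 p2 / z * (omega0 z p1 p2 ^+ 2 + pole_prod p1 p2)).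

End Feedback.

Arguments p_type {R}.
Arguments pi_type {R}.

(* Main.v *)
Require Import Defs.
From HB Require Import structures.
From mathcomp Require Import all_boot all_order all_algebra.
From mathcomp Require Import complex.
From mathcomp Require Import all_classical all_reals all_analysis.
From mathcomp Require Import ring lra.
Set Implicit Arguments.
Unset Strict Implicit.
Unset Printing Implicit Defensive.
Import Order.TTheory GRing.Theory Num.Theory.
Local Open Scope classical_set_scope.
Local Open Scope ring_scope.

(* Write S = p1 + p2, Q = p1 p2, E = Q - S z, F = z Q, a = S - z, K = k - l/s.
   Hurwitz's conditions at gain alpha give S < alpha k and alpha k z < Q for a P
   and for a PI controller alike, hence the gain margin.

   A PI controller that stabilizes P itself has l >= 0, and its loop has a gain
   crossover j omega, x = omega ^ 2 < E, at which the rotation by -t that moves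
   a closed-loop pole to j omega satisfies
     0 < tan t <= omega (E - x) / (F + a x) = tan (theta_bar omega),
   with equality only for l = 0.  The right-hand side has a unique maximum on
   0 < x < E, at the root x0 = omega0 ^ 2 of a x ^ 2 + (a E + 3 F) x - E F.  So
   no PI controller has a larger margin than theta_bar omega0, and equality
   forces l = 0 and a crossover at omega0, which determines k.

   Conversely, for that k the Hurwitz conditions of the complex quadratic
   closed-loop polynomial read S < k C and D(C) > 0, where C = cos theta and D
   is a convex quadratic polynomial with D(C0) = 0 < D'(C0) at
   C0 = cos (theta_bar omega0). *)

(** * Gain crossovers and the stationary frequency *)

(* Expressing [F] and [a] through [x0] turns [phase_tan_gap] into a polynomial
   identity. *)
Lemma stationary_param (R : realFieldType) (a E F x0 : R) :
  0 < F -> 0 < x0 < E -> a * x0 ^+ 2 + (a * E + 3 * F) * x0 - E * F = 0 ->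
  exists2 t, 0 < t & F = t * x0 * (x0 + E) /\ a = t * (E - 3 * x0).
Proof.
move=> F0 /andP[x00 x0E] h.
have p0 : 0 < x0 * (x0 + E) by apply: mulr_gt0 => //; lra.
exists (F / (x0 * (x0 + E))); first exact: divr_gt0.
split; first by field; lra.
apply/eqP; rewrite eq_sym mulrAC; apply/eqP/(canLR (mulfK _)); first lra.
lra.
Qed.

(** With the parameters of [stationary_param], [x * (E - x) ^+ 2 / (F + a * x) ^+ 2] equals
    [1 / (4 * t ^+ 2 * x0)] at [x0]. Elsewhere it falls short because of the factor [(x - x0) ^+ 2]
    in [id], so the maximum is global and needs no calculus. *)
Lemma phase_tan_gap (R : realFieldType) (a E F t x0 x : R) :
  0 < t -> F = t * x0 * (x0 + E) -> a = t * (E - 3 * x0) ->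
  0 < x0 < E -> 0 < x < E -> x != x0 ->
  4 * t ^+ 2 * x0 * x * (E - x) ^+ 2 < (F + a * x) ^+ 2.
Proof.
move=> t0 -> -> /andP[x00 x0E] /andP[xp xE] ne.
have id : (t * x0 * (x0 + E) + t * (E - 3 * x0) * x) ^+ 2
    - 4 * t ^+ 2 * x0 * x * (E - x) ^+ 2
  = t ^+ 2 * (x - x0) ^+ 2 * ((E - x0) ^+ 2 + 4 * x0 * (E - x)) by ring.
have sq : 0 < (x - x0) ^+ 2 by rewrite exprn_even_gt0 //= subr_eq0.
have E2 : 0 < (E - x0) ^+ 2 by rewrite exprn_gt0 // subr_gt0.
have xE2 : 0 < x0 * (E - x) by apply: mulr_gt0 => //; lra.
rewrite -subr_gt0 id; apply: mulr_gt0; last lra.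
by apply: mulr_gt0 => //; exact: exprn_gt0.
Qed.

(** For positive [E], [F] and [F + a * E], the chosen sign gives the positive root if [0 < a] and
    the smaller of two positive roots if [a < 0]; for [a = 0] the polynomial is linear. *)
Definition stationary_freq_sqr (R : rcfType) (a E F : R) : R :=
  let b := a * E + 3 * F in
  if a == 0 then E / 3 else
    (- b + Num.sqrt (b ^+ 2 + 4 * a * (E * F))) / (2 * a).

(** The polynomial is [- E * F < 0] at 0 and [2 * E * (F + a * E) > 0] at [E]. For the closed
    formula this becomes a comparison of [r] with [b] and with [b + 2 * a * E]. *)
Lemma stationary_freq_sqrP (R : rcfType) (a E F : R) :
  0 < E -> 0 < F -> 0 < F + a * E ->
  let x0 := stationary_freq_sqr a E F in
  0 < x0 < E /\ a * x0 ^+ 2 + (a * E + 3 * F) * x0 - E * F = 0.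
Proof.
move=> E0 F0 FE; rewrite /stationary_freq_sqr.
have [->|a0] := eqVneq a 0.
  by split; [apply/andP; split; lra | field].
set b := a * E + 3 * F; set d := b ^+ 2 + _; set r := Num.sqrt d.
have b0 : 0 < b by rewrite /b; lra.
have EF : 0 < E * F by exact: mulr_gt0.
have EFE : 0 < E * (F + a * E) by exact: mulr_gt0.
(* The discriminant seen from [E]: the square of the derivative there minus [4 * a] times the value
   there. *)
have dE : d = (b + 2 * a * E) ^+ 2 - 8 * a * (E * (F + a * E)).
  by rewrite /d /b; ring.
have c0 : 0 < b + 2 * a * E by rewrite /b; lra.
have d0 : 0 <= d.
  have [ap|an] := ltP 0 a.
    by rewrite /d addr_ge0 ?sqr_ge0 // !mulr_ge0 // ltW.
  have sq := sqr_ge0 (b + 2 * a * E).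
  have neg : a * (E * (F + a * E)) <= 0 by rewrite mulr_le0_ge0 // ltW.
  by rewrite dE; lra.
have r0 : 0 <= r by exact: sqrtr_ge0.
have rr : r ^+ 2 = d by rewrite /r sqr_sqrtr.
split; last first.
  have -> : a * ((- b + r) / (2 * a)) ^+ 2 + b * ((- b + r) / (2 * a)) - E * F
      = (r ^+ 2 - d) / (4 * a) by rewrite /d; field.
  by rewrite rr subrr mul0r.
have [ap|an] := ltP 0 a.
  have h1 : b < r.
    rewrite -(ltr_pXn2r (n:=2)) // ?nnegrE ?(ltW b0) // rr /d ltrDl.
    by rewrite !mulr_gt0.
  have h2 : r < b + 2 * a * E.
    rewrite -(ltr_pXn2r (n:=2)) // ?nnegrE ?(ltW c0) // rr dE gtrDl oppr_lt0.
    by rewrite !mulr_gt0.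
  rewrite ltr_pdivlMr ?mulr_gt0 // mul0r ltr_pdivrMr ?mulr_gt0 //.
  by apply/andP; split; lra.
have {an}an : a < 0 by rewrite lt_neqAle a0.
have h1 : r < b.
  rewrite -(ltr_pXn2r (n:=2)) // ?nnegrE ?(ltW b0) // rr /d gtrDl.
  by rewrite pmulr_llt0 //; lra.
have h2 : b + 2 * a * E < r.
  rewrite -(ltr_pXn2r (n:=2)) // ?nnegrE ?(ltW c0) // rr dE ltrDl oppr_gt0.
  by rewrite pmulr_llt0 //; lra.
by rewrite ltr_ndivlMr ?mul0r ?ltr_ndivrMr; lra.
Qed.

Lemma cubic_ivt (R : rcfType) (c3 c2 c1 c0 a b : R) :
  let f x := c3 * x ^+ 3 + c2 * x ^+ 2 + c1 * x + c0 in
  a <= b -> f a <= 0 <= f b -> exists2 x, a <= x <= b & f x = 0.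
Proof.
move=> f ab fab.
pose p := c3%:P * 'X ^+ 3 + c2%:P * 'X ^+ 2 + c1%:P * 'X + c0%:P : {poly R}.
have pE x : p.[x] = f x by rewrite /p /f !hornerE.
have [|x xab /rootP] := @poly_ivt R p a b ab; first by rewrite !pE.
by rewrite pE; exists x.
Qed.

Lemma quadratic_lt0_between (R : realFieldType) (c2 c1 c0 a b x : R) :
  0 < c2 -> c2 * a ^+ 2 + c1 * a + c0 = 0 -> c2 * b ^+ 2 + c1 * b + c0 = 0 ->
  a < x < b -> c2 * x ^+ 2 + c1 * x + c0 < 0.
Proof.
move=> c20 ha hb /andP[ax xb].
have ab : 0 < b - a by lra.
have id : (b - a) * (c2 * x ^+ 2 + c1 * x + c0) =
  (b - x) * (c2 * a ^+ 2 + c1 * a + c0) + (x - a) * (c2 * b ^+ 2 + c1 * b + c0)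
  - c2 * ((x - a) * (b - x) * (b - a)) by ring.
rewrite -(pmulr_rlt0 _ ab) id ha hb !mulr0 !add0r oppr_lt0.
apply: mulr_gt0 => //; apply: mulr_gt0 => //; apply: mulr_gt0; lra.
Qed.

(** The difference [f] of the squared moduli of [D_P] and [k N_P] is positive at 0 by [k * z < Q],
    and negative at [E], where [Q - E = S * z] and [S < k]. *)
Lemma p_crossing (R : rcfType) (S z Q k : R) :
  0 < S -> 0 < z -> S * z < Q -> S < k -> k * z < Q ->
  exists2 x, 0 < x < Q - S * z &
    (Q - x) ^+ 2 + S ^+ 2 * x = k ^+ 2 * (z ^+ 2 + x).
Proof.
move=> S0 z0 SzQ Sk kzQ; set E := Q - S * z.
have E0 : 0 < E by rewrite /E; lra.
have Sz0 : 0 < S * z by exact: mulr_gt0.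
have kz0 : 0 < k * z by apply: mulr_gt0 => //; lra.
pose f x := (Q - x) ^+ 2 + S ^+ 2 * x - k ^+ 2 * (z ^+ 2 + x).
have f0 : 0 < f 0.
  have -> : f 0 = (Q - k * z) * (Q + k * z) by rewrite /f; ring.
  apply: mulr_gt0; lra.
have fE : f E < 0.
  have -> : f E = - ((k - S) * (k + S) * (z ^+ 2 + E)) by rewrite /f /E; ring.
  rewrite oppr_lt0; apply: mulr_gt0; first by apply: mulr_gt0; lra.
  by rewrite addr_gt0 // exprn_gt0.
have [|x /andP[x0 xE] fx] := @cubic_ivt R 0 (- 1) (2 * Q - S ^+ 2 + k ^+ 2)
    (k ^+ 2 * z ^+ 2 - Q ^+ 2) 0 E (ltW E0).
  by move: f0 fE; rewrite /f => *; apply/andP; split; lra.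
have {}fx : f x = 0 by rewrite /f; lra.
exists x; last by move: fx; rewrite /f; lra.
apply/andP; split; rewrite lt_neqAle ?x0 ?xE andbT; apply/eqP => e.
  by move: f0; rewrite {2}e fx ltxx.
by move: fE; rewrite -e fx ltxx.
Qed.

(* At [j omega], with [x = omega ^ 2], the loop is real exactly at the roots of
   the convex quadratic [q].  Hurwitz's inequality [u < v], for
   [u = l z / (k - S)] and [v = Q - l - k z], puts one root below [u], where the
   loop gain is below 1, and the other above [v], where it is above 1. *)
Lemma pi_crossing (R : rcfType) (S z Q k l : R) :
  0 < S -> 0 < z -> S * z < Q -> S < k -> 0 < l -> 0 < Q - l - k * z ->
  l * z < (k - S) * (Q - l - k * z) ->
  let E := Q - S * z in let F := z * Q in let a := S - z in
  exists x, [/\ 0 < x < Q,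
    x * ((Q - x) ^+ 2 + S ^+ 2 * x) = (x + z ^+ 2) * (l ^+ 2 + k ^+ 2 * x) &
    l * (F + a * x) < k * x * (E - x)].
Proof.
move=> S0 z0 SzQ Sk l0 v0 uv E F a.
have lz0 : 0 < l * z by exact: mulr_gt0.
have kz0 : 0 < k * z by apply: mulr_gt0 => //; lra.
have Q0 : 0 < Q by lra.
have kS : 0 < k - S by lra.
set v := Q - l - k * z in v0 uv.
pose u := l * z / (k - S).
have uE : (k - S) * u = l * z by rewrite /u; field; lra.
have u0 : 0 < u by exact: divr_gt0.
have ltuv : u < v by rewrite -(ltr_pM2l kS) uE.
have vQ : v < Q by rewrite /v; lra.
(* Also [q x = l * (F + a * x) - k * x * (E - x)], so the last conclusion reads [q x < 0]. *)
pose q x := k * x ^+ 2 + (l * a - k * E) * x + l * F.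
have qE x : q x = (Q - x) * (l * z - (k - S) * x) - S * x * (v - x).
  by rewrite /q /E /F /a /v; ring.
have q0 : 0 < q 0 by rewrite (_ : q 0 = l * z * Q) ?mulr_gt0 // /q /F; ring.
have qQ : 0 < q Q.
  have -> : q Q = S * Q * (Q - v) by rewrite qE; ring.
  apply: mulr_gt0; last lra.
  exact: mulr_gt0.
have qu : q u < 0.
  rewrite qE uE subrr mulr0 add0r oppr_lt0; apply: mulr_gt0; last lra.
  exact: mulr_gt0.
have qv : q v < 0.
  have kv : (k - S) * u < (k - S) * v by rewrite ltr_pM2l.
  rewrite qE subrr mulr0 subr0 pmulr_rlt0; lra.
(* Squared modulus of the loop numerator minus that of the denominator. Up to sign they are
   [(k x - l z) + j omega (k z + l)] and [S x + j omega (Q - x)]. Where [q] vanishes they are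
   proportional, so both differences of squares in [gE] have the same sign. *)
pose g x := (x + z ^+ 2) * (l ^+ 2 + k ^+ 2 * x)
  - x * ((Q - x) ^+ 2 + S ^+ 2 * x).
have gE x : g x = ((k * x - l * z) ^+ 2 - (S * x) ^+ 2)
  + x * ((k * z + l) ^+ 2 - (Q - x) ^+ 2) by rewrite /g; ring.
have qB x : q x = S * x * (k * z + l) - (Q - x) * (k * x - l * z).
  by rewrite qE /v; ring.
have [x1 /andP[x10 x1u] qx1] : exists2 x, 0 <= x <= u & q x = 0.
  have [|x xb fx] := @cubic_ivt R 0 (- k) (- (l * a - k * E)) (- (l * F)) 0 u
    (ltW u0).
    by move: q0 qu; rewrite /q => *; apply/andP; split; lra.
  by exists x => //; rewrite /q; lra.
have [x2 /andP[vx2 x2Q] qx2] : exists2 x, v <= x <= Q & q x = 0.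
  have [|x xb fx] := @cubic_ivt R 0 k (l * a - k * E) (l * F) v Q (ltW vQ).
    by move: qv qQ; rewrite /q => *; apply/andP; split; lra.
  by exists x => //; rewrite /q; lra.
have {}x10 : 0 < x1.
  rewrite lt_neqAle x10 andbT; apply/eqP => e.
  by move: q0; rewrite {2}e qx1 ltxx.
have {}x1u : x1 < u.
  by rewrite lt_neqAle x1u andbT; apply/eqP => e; move: qu; rewrite -e qx1 ltxx.
have {}vx2 : v < x2.
  by rewrite lt_neqAle vx2 andbT; apply/eqP => e; move: qv; rewrite e qx2 ltxx.
have {}x2Q : x2 < Q.
  by rewrite lt_neqAle x2Q andbT; apply/eqP => e; move: qQ; rewrite -e qx2 ltxx.
have kzl : 0 < k * z + l by lra.
have real_ratio x : q x = 0 ->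
    (Q - x) * (k * x - l * z) = S * x * (k * z + l).
  by rewrite qB => /eqP; rewrite subr_eq0 => /eqP.
have gx1 : g x1 < 0.
  have e1 := real_ratio _ qx1.
  have Qx : 0 < Q - x1 by lra.
  have Sx : 0 < S * x1 by exact: mulr_gt0.
  have b0 : 0 < k * x1 - l * z by rewrite -(pmulr_rgt0 _ Qx) e1 mulr_gt0.
  have b1 : k * x1 - l * z < S * x1.
    by have : (k - S) * x1 < (k - S) * u; [rewrite ltr_pM2l | rewrite uE; lra].
  have b2 : k * z + l < Q - x1.
    by rewrite -(ltr_pM2l Sx) -e1 mulrC ltr_pM2r.
  have s1 : (k * x1 - l * z) ^+ 2 < (S * x1) ^+ 2.
    by rewrite ltr_pXn2r // nnegrE ltW.
  have s2 : (k * z + l) ^+ 2 < (Q - x1) ^+ 2.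
    by rewrite ltr_pXn2r // nnegrE ltW.
  rewrite gE; have := mulr_gt0 x10 (etrans (subr_gt0 _ _) s2); lra.
have gx2 : 0 < g x2.
  have e1 := real_ratio _ qx2.
  have x20 : 0 < x2 by lra.
  have Qx : 0 < Q - x2 by lra.
  have Sx : 0 < S * x2 by exact: mulr_gt0.
  have b2 : Q - x2 < k * z + l by rewrite /v in vx2; lra.
  have b1 : S * x2 < k * x2 - l * z.
    by rewrite -(ltr_pM2l Qx) e1 mulrC ltr_pM2l.
  have s1 : (S * x2) ^+ 2 < (k * x2 - l * z) ^+ 2.
    by rewrite ltr_pXn2r // nnegrE ltW //; lra.
  have s2 : (Q - x2) ^+ 2 < (k * z + l) ^+ 2.
    by rewrite ltr_pXn2r // nnegrE ltW.
  rewrite gE; have := mulr_gt0 x20 (etrans (subr_gt0 _ _) s2); lra.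
(* [g] changes sign between the two roots of [q], hence vanishes where the convex [q] is
   negative. *)
have [|x /andP[x1x xx2] gx] := @cubic_ivt R (- 1)
    (k ^+ 2 + 2 * Q - S ^+ 2) (l ^+ 2 + z ^+ 2 * k ^+ 2 - Q ^+ 2)
    (z ^+ 2 * l ^+ 2) x1 x2 (ltW (lt_trans (lt_trans x1u ltuv) vx2)).
  by move: gx1 gx2; rewrite /g => *; apply/andP; split; lra.
have {}gx : g x = 0 by rewrite /g; lra.
have {}x1x : x1 < x.
  by rewrite lt_neqAle x1x andbT; apply/eqP => e; move: gx1; rewrite e gx ltxx.
have {}xx2 : x < x2.
  by rewrite lt_neqAle xx2 andbT; apply/eqP => e; move: gx2; rewrite -e gx ltxx.
exists x; split; first by apply/andP; split; lra.
  by move: gx; rewrite /g; lra.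
have : q x < 0.
  by apply: (@quadratic_lt0_between _ _ _ _ x1 x2) => //; [lra | apply/andP].
by rewrite /q; lra.
Qed.

(** * Hurwitz conditions *)

Lemma cos_sin_atan_div (R : realType) (u v n : R) :
  0 < u -> 0 < n -> u ^+ 2 + v ^+ 2 = n ^+ 2 ->
  cos (atan (v / u)) = u / n /\ sin (atan (v / u)) = v / n.
Proof.
move=> u0 n0 h.
have c : cos (atan (v / u)) = u / n.
  rewrite cos_atan.
  have -> : 1 + (v / u) ^+ 2 = (n / u) ^+ 2.
    by rewrite !expr_div_n -h; field; lra.
  by rewrite sqrtr_sqr ger0_norm ?invf_div // divr_ge0 // ltW.
split=> //.
have := atanK (v / u); rewrite /tan c => e.
have un : u / n != 0 by rewrite mulf_neq0 ?invr_eq0 ?gt_eqF.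
by rewrite -(divfK un (sin _)) e; field; rewrite !gt_eqF.
Qed.

(** Both arctangents lie in [[0, pi/2)], so their difference stays in the principal branch. *)
Lemma atan_sub_pos (R : realType) (u v : R) : 0 <= u -> 0 <= v ->
  atan u - atan v = atan ((u - v) / (1 + u * v)).
Proof.
move=> u0 v0.
have p0 : 0 < 1 + u * v by rewrite ltr_pwDl // mulr_ge0.
have au : 0 <= atan u by rewrite -atan0 le_atan.
have av : 0 <= atan v by rewrite -atan0 le_atan.
have cn0 w : cos (@atan R w) != 0.
  by rewrite gt_eqF // cos_gt0_pihalf // atan_gtNpi2 atan_ltpi2.
apply: tan_inj.
- by rewrite in_itv /=; have := atan_ltpi2 u; have := atan_ltpi2 v; lra.
- by rewrite in_itv /= atan_gtNpi2 atan_ltpi2.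
rewrite atanK tanD ?cosN // tanN !atanK mulrN opprK //.
Qed.

(** If [s'] is the other root, the second hypothesis says that [Re s * Re s' * (Re a ^+ 2 + (Im s -
    Im s') ^+ 2)] is positive. The real parts then have the same sign, and their sum is
    [- Re a < 0]. *)
Lemma quadratic_hurwitz (R : realType) (a b s : R[i]) :
  0 < complex.Re a ->
  0 < complex.Re a ^+ 2 * complex.Re b
      + complex.Re a * complex.Im a * complex.Im b - complex.Im b ^+ 2 ->
  s ^+ 2 + a * s + b = 0 -> complex.Re s < 0.
Proof.
move=> a0 d0 h.
have bE : b = s * (- a - s).
  by apply/eqP; rewrite -subr_eq0 -[X in _ == X]h; apply/eqP; ring.
case: a a0 d0 h bE => ar ai; case: s => x y /= a0 d0 _ bE.
move: d0; rewrite bE /=.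
set d := (X in 0 < X -> _).
have -> : d = x * (- ar - x) * (ar ^+ 2 + (ai + 2 * y) ^+ 2).
  by rewrite /d; ring.
move=> d0; rewrite ltNge; apply/negP => x0.
suff : x * (- ar - x) * (ar ^+ 2 + (ai + 2 * y) ^+ 2) <= 0 by lra.
rewrite mulr_le0_ge0 ?addr_ge0 ?sqr_ge0 //.
rewrite mulr_ge0_le0 //; lra.
Qed.


(** It suffices to test one root of largest real part, written out according to the sign of the
    discriminant. *)
Lemma real_quadratic_hurwitz (R : realType) (p q : R) :
  (forall s : R[i], s ^+ 2 + real_complex R p * s + real_complex R q = 0 ->
     complex.Re s < 0) -> 0 < p /\ 0 < q.
Proof.
move=> h.
have {}h (x y : R) : x ^+ 2 - y ^+ 2 + p * x + q = 0 ->
    2 * x * y + p * y = 0 -> x < 0.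
  move=> hr hi; apply: (h (Complex x y)); apply/eqP.
  rewrite eq_complex /=; apply/andP.
  by split; apply/eqP; [rewrite -[RHS]hr; ring | rewrite -[RHS]hi; ring].
have [d0|d0] := leP 0 (p ^+ 2 - 4 * q).
  have [r r0 rr] : exists2 r, 0 <= r & r ^+ 2 = p ^+ 2 - 4 * q.
    by exists (Num.sqrt (p ^+ 2 - 4 * q)); rewrite ?sqrtr_ge0 ?sqr_sqrtr.
  have h1 : (- p + r) / 2 < 0.
    apply: (h _ 0); last by ring.
    transitivity ((r ^+ 2 - (p ^+ 2 - 4 * q)) / 4); first by field.
    by rewrite rr; ring.
  have p0 : r < p by lra.
  split; first lra.
  have -> : q = (p - r) * (p + r) / 4 by transitivity ((p ^+ 2 - r ^+ 2) / 4);
    [rewrite rr; field | field].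
  rewrite divr_gt0 // mulr_gt0 //; lra.
have [r r0 rr] : exists2 r, 0 <= r & r ^+ 2 = 4 * q - p ^+ 2.
  by exists (Num.sqrt (4 * q - p ^+ 2)); rewrite ?sqrtr_ge0 ?sqr_sqrtr //; lra.
have h1 : - p / 2 < 0.
  apply: (h _ (r / 2)); last by field.
  by transitivity ((4 * q - p ^+ 2 - r ^+ 2) / 4); [field | rewrite rr; field].
by have := sqr_ge0 p; split; lra.
Qed.

(** A Cauchy-type root bound, which supplies the endpoints between which a real cubic has a root. *)
Lemma cubic_root_ge (R : realFieldType) (b c d m : R) :
  1 + `|b| + `|c| + `|d| <= m -> 0 <= m ^+ 3 + b * m ^+ 2 + c * m + d.
Proof.
move=> hm.
have := normr_ge0 b; have := normr_ge0 c; have := normr_ge0 d => d0 c0 b0.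
have m1 : 1 <= m by lra.
have mm : m <= m ^+ 2 by rewrite ler_eXnr.
have bm := ler_norm (- b); have cm := ler_norm (- c); have dm := ler_norm (- d).
rewrite !normrN in bm cm dm.
have h1 : 0 <= (`|b| + b) * m ^+ 2 by rewrite mulr_ge0 ?sqr_ge0 //; lra.
have h2 : 0 <= (`|c| + c) * m by rewrite mulr_ge0 //; lra.
have h3 : 0 <= `|c| * (m ^+ 2 - m) by rewrite mulr_ge0 //; lra.
have h4 : 0 <= `|d| * (m ^+ 2 - 1) by rewrite mulr_ge0 //; lra.
have h5 : 0 <= m ^+ 2 * (m - (1 + `|b| + `|c| + `|d|)).
  by rewrite mulr_ge0 ?sqr_ge0 //; lra.
have h6 := sqr_ge0 m.
lra.
Qed.

(** Splitting off a real root [r] leaves [s ^+ 2 + p * s + q], with [r < 0 < p, q]; then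
    [b * c - d = p * (q - r * p + r ^+ 2)]. Roots at 0 are excluded by [d != 0]. *)
Lemma real_cubic_hurwitz (R : realType) (b c d : R) :
  d != 0 ->
  (forall s : R[i], s != 0 -> s ^+ 3 + real_complex R b * s ^+ 2
     + real_complex R c * s + real_complex R d = 0 -> complex.Re s < 0) ->
  [/\ 0 < b, 0 < c, 0 < d & d < b * c].
Proof.
move=> d0 h.
pose m := 1 + `|b| + `|c| + `|d|.
have m0 : - m <= m by rewrite ge0_cp // /m !addr_ge0.
have [|r _ hr] := @cubic_ivt R 1 b c d (- m) m m0.
  have := @cubic_root_ge R b c d m (lexx _).
  (* Flipping the signs of [b] and [d] gives minus the cubic at [- m]. *)
  have := @cubic_root_ge R (- b) c (- d) m; rewrite !normrN => /(_ (lexx _)).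
  by move=> *; apply/andP; split; lra.
pose p := b + r; pose q := c + r * p.
have dE : d = - (r * q) by rewrite /q /p; lra.
have r0 : r < 0.
  apply: (h (real_complex R r)).
    by apply/eqP => -[r0]; move: d0; rewrite dE r0 mul0r oppr0 eqxx.
  transitivity (real_complex R (1 * r ^+ 3 + b * r ^+ 2 + c * r + d)).
    by rewrite mul1r !(rmorphD, rmorphXn, rmorphM).
  by rewrite hr.
have [p0 q0] : 0 < p /\ 0 < q.
  apply: real_quadratic_hurwitz => s hs; apply: h.
    apply/eqP => s0; move: hs; rewrite s0 expr0n mulr0 !add0r => -[q0].
    by move: d0; rewrite dE q0 mulr0 oppr0 eqxx.
  have bE : b = p - r by rewrite /p; ring.
  have cE : c = q - r * p by rewrite /q; ring.
  rewrite dE cE bE !rmorphB !rmorphN !rmorphM.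
  rewrite -[RHS](mulr0 (s - real_complex R r)) -hs; ring.
have rp : 0 < - r * p by rewrite mulr_gt0 // oppr_gt0.
have rq : 0 < - r * q by rewrite mulr_gt0 // oppr_gt0.
have pq : 0 < p * q by exact: mulr_gt0.
have rpp : 0 < - r * p * p by exact: mulr_gt0.
have rrp : 0 < - r * (- r * p) by rewrite mulr_gt0 // oppr_gt0.
have bE : b = p - r by rewrite /p; ring.
have cE : c = q - r * p by rewrite /q; ring.
by split; rewrite ?dE ?bE ?cE; lra.
Qed.

(** * Closed-loop poles *)

Lemma pole_symmetric_functions (R : realType) (p1 p2 : R[i]) :
  0 < complex.Re p1 -> 0 < complex.Re p2 ->
  (complex.Im p1 = 0 /\ complex.Im p2 = 0) \/ p2 = conjc p1 ->
  let S := pole_sum p1 p2 in let Q := pole_prod p1 p2 in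
  [/\ 0 < S, 0 < Q, p1 + p2 = real_complex R S & p1 * p2 = real_complex R Q] /\
  pole_sqsum p1 p2 = S ^+ 2 - 2 * Q /\ pole_sqdiff p1 p2 = S ^+ 2 - 4 * Q.
Proof.
rewrite /pole_sum /pole_prod /pole_sqsum /pole_sqdiff.
case: p1 => a b; case: p2 => c d /= a0 c0 [[-> ->]|[-> ->]].
  split; last by split; ring.
  split; [exact: addr_gt0 | by rewrite mulr0 subr0 mulr_gt0 | |].
    by apply/eqP; rewrite eq_complex /= addr0 !eqxx.
  by apply/eqP; rewrite eq_complex /= !mulr0 !mul0r addr0 !eqxx.
split; last by split; ring.
split; [exact: addr_gt0 | | |].
- by rewrite mulrN opprK ltr_pwDl ?mulr_gt0 // -expr2 sqr_ge0.
- by apply/eqP; rewrite eq_complex /= subrr !eqxx.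
- by apply/eqP; rewrite eq_complex /= eqxx; apply/eqP; ring.
Qed.

Lemma pi_controller_tofrac (R : realType) (k ki : R) (N D : {poly R}) :
  D != 0 -> pi_controller k ki = FracField.tofrac N / FracField.tofrac D ->
  N * 'X = (k%:P * 'X + ki%:P) * D.
Proof.
move=> D0 h; apply/eqP; rewrite -tofrac_eq !(tofracM, tofracD).
have X0 : FracField.tofrac ('X : {poly R}) != 0 by rewrite tofrac_eq0 polyX_eq0.
have {}D0 : FracField.tofrac D != 0 by rewrite tofrac_eq0.
have clear_denom (F : fieldType) (a b x n d : F) : x != 0 -> d != 0 ->
    a + b / x = n / d -> n * x = (a * x + b) * d.
  move=> x0 d0 e; rewrite -[n](divfK d0) -e; field; exact: x0.
by rewrite (clear_denom _ _ _ _ _ _ X0 D0 h).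
Qed.

(** From [N * 'X = (k%:P * 'X + ki%:P) * D], [s] times the characteristic polynomial is [D] times
    the expected cubic, whence the restriction [s != 0]. For [ki = 0] the controller has no pole at
    0 and the quadratic is treated directly, at every [s]. *)
Lemma stabilizes_pi_roots (R : realType) (z : R) (p1 p2 c : R[i]) (k ki : R) :
  stabilizes c (plant z p1 p2) (pi_controller k ki) ->
  (forall s : R[i], s != 0 ->
    s * ((s - p1) * (s - p2)) + c * ((s - real_complex R z)
      * (real_complex R k * s + real_complex R ki)) = 0 -> complex.Re s < 0) /\
  (ki = 0 -> forall s : R[i],
    (s - p1) * (s - p2) + c * ((s - real_complex R z) * real_complex R k) = 0 ->
    complex.Re s < 0).
Proof.
case=> N [D [D0 _ /(pi_controller_tofrac D0) ND /= [_ _ stab]]].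
split=> [s s0 hs | ki0 s hs]; apply: stab; rewrite /root; apply/eqP.
  have := congr1 (fun p => (map_poly (real_complex R) p).[s]) ND.
  rewrite /= !(rmorphD, rmorphM) /= !map_polyC /= map_polyX !hornerE /= => e.
  apply: (mulIf s0); rewrite mul0r.
  set n := (map_poly _ N).[s] in e *; set d := (map_poly _ D).[s] in e *.
  transitivity (s * (s - p1) * (s - p2) * d
    + c * (s - real_complex R z) * (n * s)); first ring.
  rewrite e -[RHS](mul0r d) -hs; ring.
have {}ND : N = k%:P * D.
  apply: (mulIf (negbT (polyX_eq0 R))); rewrite ND ki0; ring.
rewrite ND rmorphM /= map_polyC /= !hornerE /=.
rewrite -[RHS](mul0r (map_poly (real_complex R) D).[s]) -hs; ring.
Qed.

Lemma stabilizes_p_controller (R : realType) (z : R) (p1 p2 c : R[i]) (k : R) :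
  (forall s : R[i],
    (s - p1) * (s - p2) + c * ((s - real_complex R z) * real_complex R k) = 0 ->
    complex.Re s < 0) ->
  stabilizes c (plant z p1 p2) (p_controller k).
Proof.
move=> h; exists k%:P, 1; split.
- exact: oner_neq0.
- exact: coprimep1.
- by rewrite tofrac1 divr1.
rewrite /= rmorph1 mulr1 map_polyC /=.
have sz2 : size (('X - p1%:P) * ('X - p2%:P)) = 3.
  by rewrite size_mul ?polyXsubC_eq0 // !size_XsubC.
(* Only an inequality, since [k] may be 0. *)
have sz1 :
    (size (('X - (real_complex R z)%:P) * (real_complex R k)%:P)%R <= 2)%N.
  by rewrite mulrC mul_polyC (leq_trans (size_scale_leq _ _)) // size_XsubC.
rewrite sz2; split.
- exact: leq_trans sz1 _.
- by rewrite size_polyDl sz2 // (leq_ltn_trans (size_scale_leq _ _)).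
- move=> s /rootP; rewrite !hornerE /= => e; apply: h; rewrite -[RHS]e; ring.
Qed.

Lemma p_controllerE (R : realType) (k : R) : pi_controller k 0 = p_controller k.
Proof. by rewrite /pi_controller !rmorph0 mul0r addr0. Qed.

Lemma pole_polyE (R : realType) (S Q : R) (p1 p2 s : R[i]) :
  p1 + p2 = real_complex R S -> p1 * p2 = real_complex R Q ->
  (s - p1) * (s - p2) = s ^+ 2 - real_complex R S * s + real_complex R Q.
Proof. by move=> <- <-; ring. Qed.

(** Hurwitz's conditions for the quadratic if [ki = 0], and for the cubic otherwise. The constant
    term [- al * ki * z] forces the sign of [ki]. *)
Lemma stabilizes_real_gain (R : realType) (z S Q al k ki : R) (p1 p2 : R[i]) :
  0 < z -> 0 < al ->
  p1 + p2 = real_complex R S -> p1 * p2 = real_complex R Q ->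
  stabilizes (real_complex R al) (plant z p1 p2) (pi_controller k ki) ->
  [/\ S < al * k, al * (k * z - ki) < Q, ki <= 0 &
    ki != 0 -> - (al * ki * z) < (al * k - S) * (Q + al * ki - al * k * z)].
Proof.
move=> z0 al0 hS hQ /stabilizes_pi_roots[stab1 stab0].
have [ki0|ki0] := eqVneq ki 0.
  have [] := @real_quadratic_hurwitz R (al * k - S) (Q - al * k * z).
    move=> s hs; apply: (stab0 ki0); rewrite -[RHS]hs.
    rewrite (pole_polyE _ hS hQ); ring.
  by rewrite ki0 lexx => p0 q0; split=> //; lra.
have [||b0 c0 d0 dbc] :=
    @real_cubic_hurwitz R (al * k - S) (Q + al * ki - al * k * z)
      (- (al * ki * z)).
- by rewrite oppr_eq0 !mulf_neq0 // gt_eqF.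
- move=> s s0 hs; apply: (stab1 _ s0); rewrite -[RHS]hs.
  rewrite (pole_polyE _ hS hQ); ring.
have ki0' : al * ki < 0 by rewrite -(pmulr_llt0 _ z0); lra.
split; [lra | lra | | by []].
by rewrite ltW // -(pmulr_rlt0 _ al0).
Qed.

(** [quadratic_hurwitz] for [s ^+ 2 + (c k - S) s + Q - c k z]. The sine [D] enters only through
    [D ^+ 2 = 1 - C ^+ 2]. *)
Lemma p_controller_stabilizes (R : realType) (z S Q k C D : R) (p1 p2 : R[i]) :
  p1 + p2 = real_complex R S -> p1 * p2 = real_complex R Q ->
  C ^+ 2 + D ^+ 2 = 1 -> S < k * C ->
  0 < k ^+ 2 * (Q + S * z + z ^+ 2) * C ^+ 2
      - k * (2 * S * Q + z * S ^+ 2 + k ^+ 2 * z) * C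
      + S ^+ 2 * Q + k ^+ 2 * z * (S - z) ->
  stabilizes (Complex C (- D)) (plant z p1 p2) (p_controller k).
Proof.
move=> hS hQ CD SkC d0; apply: stabilizes_p_controller => s hs.
set c := Complex C (- D) in hs.
apply: (@quadratic_hurwitz R (c * real_complex R k - real_complex R S)
          (real_complex R Q - c * real_complex R (k * z))).
- by rewrite /=; lra.
- rewrite /=.
  set e := (X in 0 < X).
  have -> // : e = k ^+ 2 * (Q + S * z + z ^+ 2) * C ^+ 2
      - k * (2 * S * Q + z * S ^+ 2 + k ^+ 2 * z) * C
      + S ^+ 2 * Q + k ^+ 2 * z * (S - z).
  have DE : D ^+ 2 = 1 - C ^+ 2 by lra.
  transitivity ((k * C - S) ^+ 2 * (Q - k * z * C) 
    - (k * C - S) * k ^+ 2 * z * D ^+ 2 - k ^+ 2 * z ^+ 2 * D ^+ 2).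
    by rewrite /e; ring.
  by rewrite DE; ring.
- rewrite -[RHS]hs (pole_polyE _ hS hQ); ring.
Qed.

(* Closed-loop poles on the imaginary axis: with [A = D_P D_K] and
   [B = - N_P N_K] at [j omega] and [|A| = |B|], the rotation that puts
   [j omega] among the closed-loop poles has the angle of [B / A]. *)
Lemma pi_imaginary_pole (R : realType) (z S Q k l w : R) (p1 p2 : R[i]) :
  p1 + p2 = real_complex R S -> p1 * p2 = real_complex R Q -> 0 < w ->
  let x := w ^+ 2 in
  let re := k * (z * Q + (S - z) * x) + l * (Q - S * z - x) in
  let im := k * x * (Q - S * z - x) - l * (z * Q + (S - z) * x) in
  x * ((Q - x) ^+ 2 + S ^+ 2 * x) = (x + z ^+ 2) * (l ^+ 2 + k ^+ 2 * x) ->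
  0 < S -> 0 < re ->
  ~ stabilizes (phase_rotation (- atan (im / (w * re)))) (plant z p1 p2)
      (pi_controller k (- l)).
Proof.
move=> hS hQ w0 x re im xE S0 re0 /stabilizes_pi_roots[stab _].
have x0 : 0 < x by rewrite exprn_gt0.
have n0 : 0 < w * ((Q - x) ^+ 2 + S ^+ 2 * x).
  by rewrite mulr_gt0 // ltr_wpDl ?sqr_ge0 // mulr_gt0 ?exprn_gt0.
set n := _ * _ in n0.
have nE : w * n = (x + z ^+ 2) * (l ^+ 2 + k ^+ 2 * x).
  by rewrite -xE /n /x; ring.
(* [w * re - j * im] is [B] times the conjugate of [A], divided by [w]; its modulus is [n], because
   [|A| = |B|]. *)
have [||C D] := @cos_sin_atan_div R (w * re) im n _ n0; first exact: mulr_gt0.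
  apply: (mulfI (lt0r_neq0 x0)).
  transitivity ((w * n) * (w * n)); last by rewrite /x; ring.
  by rewrite {1}nE /n /re /im /x; ring.
have w0' : Complex 0 w != 0 by apply/eqP => -[w00]; move: w0; rewrite w00 ltxx.
suff h : Complex 0 w * ((Complex 0 w - p1) * (Complex 0 w - p2))
    + phase_rotation (- atan (im / (w * re)))
      * ((Complex 0 w - real_complex R z)
         * (real_complex R k * Complex 0 w + real_complex R (- l))) = 0.
  by have := stab _ w0' h; rewrite ltxx.
rewrite (pole_polyE _ hS hQ) /phase_rotation cosN sinN C D opprK.
apply/eqP; rewrite eq_complex /=; apply/andP; split; apply/eqP.
- have e : w * re * (z * l - x * k) + im * (w * (z * k + l)) = - (S * x * n).
    apply: (mulfI (lt0r_neq0 w0)).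
    transitivity (- (S * x * (w * n))); last by ring.
    by rewrite nE /re /im /x; ring.
  transitivity (S * x
    + (w * re * (z * l - x * k) + im * (w * (z * k + l))) / n).
    by rewrite /x; ring.
  by rewrite e; field; rewrite gt_eqF.
- have e : im * (z * l - x * k) - w * re * (w * (z * k + l))
      = - (w * (Q - x) * n).
    apply: (mulfI (lt0r_neq0 w0)).
    transitivity (- (w * (Q - x) * (w * n))); last by ring.
    by rewrite nE /re /im /x; ring.
  transitivity (w * (Q - x)
    + (im * (z * l - x * k) - w * re * (w * (z * k + l))) / n).
    by rewrite /x; ring.
  by rewrite e; field; rewrite gt_eqF.
Qed.

(** * Margins *)

(** Integral action lowers [im] and raises [re], so [T] is at most its value [r * (E - x) / w] for
    [l = 0], which is largest at [x0]. *)
Lemma pi_phase_tan_bound (R : realFieldType) (a E F k l r r0 : R) :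
  0 < F -> 0 < F + a * E -> 0 < r -> 0 < r0 -> 0 < k -> 0 <= l ->
  let x := r ^+ 2 in let x0 := r0 ^+ 2 in
  x < E -> x0 < E -> a * x0 ^+ 2 + (a * E + 3 * F) * x0 - E * F = 0 ->
  let w := F + a * x in
  l * w < k * x * (E - x) ->
  let re := k * w + l * (E - x) in let im := k * x * (E - x) - l * w in
  let T := im / (r * re) in let T0 := r0 * (E - x0) / (F + a * x0) in
  [/\ 0 < re, 0 < T & T < T0 \/ [/\ T = T0, x = x0 & l = 0]].
Proof.
move=> F0 FE rp r0p k0 l0 x x0 xE x0E stat w lw re im T T0.
have xp : 0 < x by rewrite exprn_gt0.
have x0p : 0 < x0 by rewrite exprn_gt0.
have x0b : 0 < x0 < E by rewrite x0p.
have xb : 0 < x < E by rewrite xp.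
have [t tp [Ft at_]] := stationary_param F0 x0b stat.
have Ep : 0 < E by lra.
(* [w] is affine in [x] and positive at 0 and at [E]. *)
have w0 : 0 < w.
  rewrite -(pmulr_rgt0 _ Ep) (_ : E * w = F * (E - x) + (F + a * E) * x).
    by rewrite addr_gt0 // mulr_gt0 // subr_gt0.
  by rewrite /w; ring.
have Ex : 0 < E - x by lra.
have re0 : 0 < re.
  by apply: ltr_pwDl; [exact: mulr_gt0 | apply: mulr_ge0 => //; exact: ltW].
have im0 : 0 < im by rewrite subr_gt0.
have T0E : T0 = (2 * t * r0)^-1.
  rewrite /T0 Ft at_.
  have -> : t * x0 * (x0 + E) + t * (E - 3 * x0) * x0 = 2 * t * x0 * (E - x0).
    by ring.
  by rewrite /x0; field; rewrite !gt_eqF // subr_gt0.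
have tr0 : 0 < 2 * t * r0 by rewrite !mulr_gt0.
have rre : 0 < r * re by exact: mulr_gt0.
split; [by [] | exact: divr_gt0 |].
(* The loss is split into two terms due to [l] and one due to [x] differing from [x0]. *)
have gapE : 2 * t * r0 * im + (l * (2 * t * r0 * w) + l * r * (E - x)) =
    r * re - r * k * (w - 2 * t * r0 * r * (E - x)).
  by rewrite /re /im /x; ring.
have lw0 : 0 <= l * (2 * t * r0 * w) by rewrite mulr_ge0 // ltW // mulr_gt0.
have lr0 : 0 <= l * r * (E - x) by rewrite mulr_ge0 ?mulr_ge0 // ltW.
have rk : 0 < r * k by exact: mulr_gt0.
have slack (A B C D G : R) : A + (B + C) = G - D ->
    0 <= B -> 0 <= C -> 0 <= D -> 0 < C + D -> A < G by lra.
have TT0 : (T < T0) = (2 * t * r0 * im < r * re).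
  by rewrite T0E ltr_pdivrMr // mulrC ltr_pdivlMr // mulrC.
have [xx0|xx0] := eqVneq x x0; last first.
  left; rewrite TT0.
  have := phase_tan_gap tp Ft at_ x0b xb xx0; rewrite -/w => gap.
  have : 2 * t * r0 * r * (E - x) < w.
    rewrite -(ltr_pXn2r (n:=2)) // ?nnegrE ?(ltW w0) //.
      by move: gap; rewrite /x /x0; lra.
    by rewrite !mulr_ge0 // ltW.
  rewrite -subr_gt0 => /(mulr_gt0 rk) h.
  by apply: (slack _ _ _ _ _ gapE) => //; [exact: ltW | exact: ltr_wpDl].
have rr0 : r = r0.
  by apply/eqP; rewrite -(@eqrXn2 _ 2) // ?ltW //; apply/eqP.
have weq : w = 2 * t * r0 * r * (E - x).
  by rewrite /w Ft at_ /x rr0 /x0; ring.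
have [l00|l00] := eqVneq l 0.
  right; split=> //.
  by rewrite T0E /T /im /re l00 !mul0r addr0 subr0 weq rr0 /x rr0; field;
     rewrite ?gt_eqF //; move: Ex; rewrite /x rr0.
left; rewrite TT0.
have lp : 0 < l by rewrite lt_neqAle eq_sym l00.
have lrE := mulr_gt0 (mulr_gt0 lp rp) Ex.
apply: (slack _ _ _ _ _ gapE) => //; first by rewrite weq subrr mulr0.
by rewrite ltr_pwDl // weq subrr mulr0.
Qed.

(** The angle is that of [pi_imaginary_pole] at the crossover. The equality case is kept because it
    identifies the optimal coefficients. *)
Lemma pi_phase_bound (R : realType) (z S Q k ki w0 : R) (p1 p2 : R[i]) :
  0 < z -> 0 < S -> S * z < Q ->
  p1 + p2 = real_complex R S -> p1 * p2 = real_complex R Q ->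
  let E := Q - S * z in let F := z * Q in let a := S - z in
  let x0 := w0 ^+ 2 in
  0 < w0 -> x0 < E -> a * x0 ^+ 2 + (a * E + 3 * F) * x0 - E * F = 0 ->
  let tmax := atan (w0 * (E - x0) / (F + a * x0)) in
  stabilizes (phase_rotation 0) (plant z p1 p2) (pi_controller k ki) ->
  exists2 t,
    ~ stabilizes (phase_rotation t) (plant z p1 p2) (pi_controller k ki) &
    `|t| < tmax \/
    [/\ `|t| = tmax, ki = 0, S < k &
      k ^+ 2 * (z ^+ 2 + x0) = (Q - x0) ^+ 2 + S ^+ 2 * x0].
Proof.
move=> z0 S0 SzQ hS hQ E F a x0 w00 x0E stat tmax.
rewrite {1}/phase_rotation cos0 sin0 oppr0 -[Complex 1 0]/(real_complex R 1).
move=> /(stabilizes_real_gain z0 ltr01 hS hQ).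
rewrite !mul1r => -[Sk kQ ki0 hur].
have F0 : 0 < F by rewrite mulr_gt0 //; have := mulr_gt0 S0 z0; lra.
have E0 : 0 < E by rewrite /E; lra.
have FE : 0 < F + a * E.
  have -> : F + a * E = S * (E + z ^+ 2) by rewrite /F /a /E; ring.
  by rewrite mulr_gt0 // addr_gt0 // exprn_gt0.
have k0 : 0 < k by lra.
pose l := - ki.
have l0 : 0 <= l by rewrite oppr_ge0.
have [x [xp xE xc xl]] : exists x, [/\ 0 < x, x < E,
    x * ((Q - x) ^+ 2 + S ^+ 2 * x) = (x + z ^+ 2) * (l ^+ 2 + k ^+ 2 * x) &
    l * (F + a * x) < k * x * (E - x)].
  have [ki00|kin0] := eqVneq ki 0.
    have [|x /andP[xp xE] xc] := @p_crossing R S z Q k S0 z0 SzQ Sk.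
      by move: kQ; rewrite ki00; lra.
    exists x; split=> //; first by rewrite xc /l ki00; ring.
    by rewrite /l ki00 oppr0 mul0r !mulr_gt0 // subr_gt0.
  have lp : 0 < l by rewrite lt_neqAle l0 eq_sym oppr_eq0 kin0.
  have hur' : l * z < (k - S) * (Q - l - k * z).
    by have := hur kin0; rewrite /l; lra.
  have [|x [/andP[xp xQ] xc xl]] := pi_crossing S0 z0 SzQ Sk lp _ hur'.
    by rewrite /l; lra.
  (* [pi_crossing] bounds [x] by [Q] only; [F + a * x > 0] and its last inequality give [x < E]. *)
  exists x; split=> //.
  have Fax : 0 < F + a * x.
    have -> : F + a * x = z * (Q - x) + S * x by rewrite /F /a; ring.
    by rewrite addr_gt0 // mulr_gt0 // subr_gt0.
  have : 0 < k * x * (E - x) by apply: lt_trans xl; exact: mulr_gt0.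
  by rewrite pmulr_rgt0 ?subr_gt0 // mulr_gt0.
pose r := Num.sqrt x.
have r0 : 0 < r by rewrite sqrtr_gt0.
have rx : x = r ^+ 2 by rewrite sqr_sqrtr // ltW.
rewrite rx in xE xc xl.
have [re0 T0 TT0] := pi_phase_tan_bound F0 FE r0 w00 k0 l0 xE x0E stat xl.
have := pi_imaginary_pole hS hQ r0 xc S0 re0.
rewrite -/E -/F -/a /l opprK.
set T := _ / _ in T0 TT0 *; move=> nst.
exists (- atan T) => //.
have aT0 : 0 <= atan T by rewrite -atan0 le_atan // ltW.
rewrite normrN ger0_norm //; case: TT0 => [lt|[eqT eqx l00]].
  by left; exact: lt_atan.
right; split=> //; first by rewrite eqT.
  by apply/eqP; rewrite -oppr_eq0 -/l l00.
rewrite -/x0 in eqx; rewrite eqx l00 in xc.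
have x00 : 0 < x0 by rewrite exprn_gt0.
by apply: (mulfI (lt0r_neq0 x00)); rewrite xc; ring.
Qed.

(** Multiplied by [z], the two sides differ exactly by the stationarity polynomial at [x0]. *)
Lemma optimal_gain_crossing (R : realFieldType) (z S Q k x0 : R) :
  0 < z ->
  let E := Q - S * z in let F := z * Q in let a := S - z in
  a * x0 ^+ 2 + (a * E + 3 * F) * x0 - E * F = 0 ->
  k ^+ 2 = S / z * (x0 + Q) ->
  k ^+ 2 * (z ^+ 2 + x0) = (Q - x0) ^+ 2 + S ^+ 2 * x0.
Proof.
move=> z0 E F a stat kE.
have kz : k ^+ 2 * z = S * (x0 + Q) by rewrite kE; field; rewrite gt_eqF.
apply: (mulfI (lt0r_neq0 z0)); rewrite mulrA (mulrC z) kz.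
by move: stat; rewrite /E /F /a; lra.
Qed.

Lemma optimal_discriminant_gt0 (R : realFieldType) (z S Q k x0 C : R) :
  0 < z -> 0 < S -> S * z < Q ->
  let E := Q - S * z in let F := z * Q in let a := S - z in
  0 < x0 < E -> a * x0 ^+ 2 + (a * E + 3 * F) * x0 - E * F = 0 ->
  0 < k -> k ^+ 2 = S / z * (x0 + Q) ->
  (F + a * x0) / (k * (z ^+ 2 + x0)) < C ->
  S < k * C /\
  0 < k ^+ 2 * (Q + S * z + z ^+ 2) * C ^+ 2
      - k * (2 * S * Q + z * S ^+ 2 + k ^+ 2 * z) * C
      + S ^+ 2 * Q + k ^+ 2 * z * (S - z).
Proof.
move=> z0 S0 SzQ E F a /andP[x00 x0E] stat k0 kE; set C0 := _ / _ => C0C.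
set G := Q + S * z + z ^+ 2.
have Sz0 : 0 < S * z by exact: mulr_gt0.
have z20 : 0 < z ^+ 2 by rewrite exprn_gt0.
have Y0 : 0 < z ^+ 2 + x0 by lra.
have C0E : k * C0 = (F + a * x0) / (z ^+ 2 + x0).
  by rewrite /C0; field; rewrite !gt_eqF.
have kC : k * C0 < k * C by rewrite ltr_pM2l.
split.
  apply: le_lt_trans kC; rewrite C0E ler_pdivlMr //.
  have : 0 <= z * (E - x0) by rewrite mulr_ge0 // ltW // subr_gt0.
  by rewrite /E /F /a; lra.
have kz : k ^+ 2 * z = S * (x0 + Q) by rewrite kE; field; rewrite gt_eqF.
have kY := optimal_gain_crossing z0 stat kE.
pose dl c := k ^+ 2 * G * c ^+ 2 - k * (2 * S * Q + z * S ^+ 2 + k ^+ 2 * z) * c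
      + S ^+ 2 * Q + k ^+ 2 * z * (S - z).
(* At the angle with cosine [C0] a closed-loop pole is imaginary, so the Hurwitz determinant
   vanishes. The crossover equation eliminates [k]. *)
have dl0 : dl C0 = 0.
  have YY : (z ^+ 2 + x0) ^+ 2 != 0 by rewrite gt_eqF // exprn_gt0.
  apply: (mulIf YY); rewrite mul0r.
  transitivity (G * (F + a * x0) ^+ 2
    - (2 * S * Q + z * S ^+ 2) * (F + a * x0) * (z ^+ 2 + x0)
    - z * (F + a * x0) * (k ^+ 2 * (z ^+ 2 + x0))
    + S ^+ 2 * Q * (z ^+ 2 + x0) ^+ 2
    + z * (S - z) * (z ^+ 2 + x0) * (k ^+ 2 * (z ^+ 2 + x0))).
    have -> : dl C0 = G * (k * C0) ^+ 2
        - (2 * S * Q + z * S ^+ 2 + k ^+ 2 * z) * (k * C0)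
        + S ^+ 2 * Q + k ^+ 2 * z * (S - z) by rewrite /dl; ring.
    by rewrite C0E; field; rewrite gt_eqF.
  by rewrite kY /G /F /a; ring.
have slope : 0 < 2 * G * (k * C0) - (2 * S * Q + z * S ^+ 2 + k ^+ 2 * z).
  rewrite C0E kz.
  have -> : 2 * G * ((F + a * x0) / (z ^+ 2 + x0))
      - (2 * S * Q + z * S ^+ 2 + S * (x0 + Q)) =
    (2 * G * (F + a * x0) - S * (3 * Q + z * S + x0) * (z ^+ 2 + x0))
      / (z ^+ 2 + x0) by field; rewrite gt_eqF.
  rewrite divr_gt0 //.
  (* Equality modulo the stationarity equation. Both factors of the first product on the right
     exceed [S * z]. *)
  have -> : 2 * G * (F + a * x0) - S * (3 * Q + z * S + x0) * (z ^+ 2 + x0) =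
    z * ((Q - x0) * (Q + x0 + 2 * z ^+ 2) - S * z * (S * z)).
    by move: stat; rewrite /G /E /F /a; lra.
  rewrite mulr_gt0 // subr_gt0 ltr_pM //; rewrite /E in x0E; lra.
rewrite -/(dl C).
(* Taylor expansion at [C0]. *)
have -> : dl C = (C - C0) * (k ^+ 2 * G * (C - C0)
    + k * (2 * G * (k * C0) - (2 * S * Q + z * S ^+ 2 + k ^+ 2 * z))).
  by rewrite -[LHS]subr0 -dl0 /dl; ring.
have CC : 0 < C - C0 by rewrite subr_gt0.
have G0 : 0 < G by rewrite /G; lra.
rewrite mulr_gt0 // addr_gt0 // mulr_gt0 // mulr_gt0 // exprn_gt0 //.
Qed.

Lemma optimal_p_stabilizes (R : realType) (z S Q k w0 t : R) (p1 p2 : R[i]) :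
  0 < z -> 0 < S -> S * z < Q ->
  p1 + p2 = real_complex R S -> p1 * p2 = real_complex R Q ->
  let E := Q - S * z in let F := z * Q in let a := S - z in
  let x0 := w0 ^+ 2 in
  0 < w0 -> x0 < E -> a * x0 ^+ 2 + (a * E + 3 * F) * x0 - E * F = 0 ->
  0 < k -> k ^+ 2 = S / z * (x0 + Q) ->
  `|t| < atan (w0 * (E - x0) / (F + a * x0)) ->
  stabilizes (phase_rotation t) (plant z p1 p2) (p_controller k).
Proof.
move=> z0 S0 SzQ hS hQ E F a x0 w00 x0E stat k0 kE tlt.
have x00 : 0 < x0 by rewrite exprn_gt0.
have Fax : 0 < F + a * x0.
  have -> : F + a * x0 = z * (E - x0 + S * z) + S * x0.
    by rewrite /F /a /E; ring.
  by rewrite addr_gt0 ?mulr_gt0 // ltr_pwDl ?subr_gt0 // mulr_ge0 ?ltW.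
have n0 : 0 < k * (z ^+ 2 + x0) by rewrite mulr_gt0 // addr_gt0 // exprn_gt0.
have [|cT _] := @cos_sin_atan_div R (F + a * x0) (w0 * (E - x0)) _ Fax n0.
  have kY := optimal_gain_crossing z0 stat kE.
  (* The sum of squares is [|N_P|^2 |D_P|^2] at [j w0], and [|D_P| = k |N_P|] at the crossover. *)
  transitivity ((z ^+ 2 + x0) * (k ^+ 2 * (z ^+ 2 + x0))); last by ring.
  by rewrite kY /E /F /a /x0; ring.
have x0b : 0 < x0 < E by rewrite x00.
have cosC : (F + a * x0) / (k * (z ^+ 2 + x0)) < cos t.
  have pi0 := pi_gt0 R.
  have := atan_ltpi2 (w0 * (E - x0) / (F + a * x0)); have := normr_ge0 t.
  move=> t0 tpi; rewrite -cT -(cos_norm t) ltr_cos // in_itv /=;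
    apply/andP; split; lra.
have [SkC d0] := optimal_discriminant_gt0 z0 S0 SzQ x0b stat k0 kE cosC.
exact: (p_controller_stabilizes hS hQ (cos2Dsin2 t) SkC d0).
Qed.

Lemma omega0E (R : realType) (z : R) (p1 p2 : R[i]) :
  0 < z ->
  let S := pole_sum p1 p2 in let Q := pole_prod p1 p2 in
  0 < S ->
  pole_sqsum p1 p2 = S ^+ 2 - 2 * Q -> pole_sqdiff p1 p2 = S ^+ 2 - 4 * Q ->
  omega0 z p1 p2 =
    Num.sqrt (stationary_freq_sqr (S - z) (Q - S * z) (z * Q)).
Proof.
move=> z0 S Q S0 hs hd; rewrite /omega0 /stationary_freq_sqr -/S -/Q hs hd.
rewrite subr_eq0; case: eqVneq => [->|Sz]; first by rewrite expr2.
move: S Q S0 Sz {hs hd} => S Q S0 Sz; congr Num.sqrt.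
set e := (X in Num.sqrt X); set d := (X in _ = (_ + Num.sqrt X) / _).
have zS : 0 <= z * S by rewrite ltW // mulr_gt0.
(* The radicand in [omega0] is the discriminant divided by [(z * S) ^+ 2]. *)
have -> : d = (z * S) ^+ 2 * e by rewrite /d /e; field; rewrite !gt_eqF.
rewrite sqrtrM ?sqr_ge0 // sqrtr_sqr ger0_norm //.
have Sz' : S - z != 0 by rewrite subr_eq0.
by field; rewrite Sz' !gt_eqF.
Qed.

Lemma theta_barE (R : realType) (z : R) (p1 p2 : R[i]) (w : R) :
  let S := pole_sum p1 p2 in let Q := pole_prod p1 p2 in
  0 < z -> 0 < S -> 0 < w -> w ^+ 2 < Q ->
  theta_bar z p1 p2 w =
    atan (w * (Q - S * z - w ^+ 2) / (z * Q + (S - z) * w ^+ 2)).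
Proof.
move=> S Q z0 S0 w0 xQ; rewrite /theta_bar /atan_quot -/S -/Q subr_eq0.
have Qx : 0 < Q - w ^+ 2 by rewrite subr_gt0.
have Fax : 0 < z * (Q - w ^+ 2) + S * w ^+ 2.
  by rewrite addr_gt0 // mulr_gt0 // exprn_gt0.
rewrite gt_eqF // atan_sub_pos; last 2 first.
- by rewrite divr_ge0 // ltW.
- by rewrite divr_ge0 // ltW // mulr_gt0.
move: S Q S0 Qx Fax {xQ} => S Q S0 Qx Fax.
congr atan; field.
by rewrite !gt_eqF // ?mulr_gt0 //; lra.
Qed.

(** Any class between P and PI has the same margin. Above [M], the conditions at gains 1 and [M]
    already conflict: [S < k] gives [Q = M * S * z < M * k * z], and [ki <= 0]. *)
Lemma gain_marginE (R : realType) (z S Q : R) (p1 p2 : R[i])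
    (X : set {fraction {poly R}}) :
  0 < z -> 0 < S -> S * z < Q ->
  p1 + p2 = real_complex R S -> p1 * p2 = real_complex R Q ->
  p_type `<=` X -> X `<=` pi_type ->
  gain_margin (plant z p1 p2) X = (Q / (z * S))%:E.
Proof.
move=> z0 S0 SzQ hS hQ pX Xpi; set M := Q / (z * S).
have zS : 0 < z * S by exact: mulr_gt0.
have M1 : 1 < M by rewrite ltr_pdivlMr // mul1r mulrC.
apply/eqP; rewrite eq_le; apply/andP; split.
  apply: ge_ereal_sup => _ [mu [K /Xpi[k [ki ->]] st] <-].
  rewrite lee_fin leNgt; apply/negP => Mmu.
  have [|Sk _ _ _] := stabilizes_real_gain z0 ltr01 hS hQ (st 1 _).
    by rewrite lexx (lt_trans M1).
  have M0 : 0 < M by lra.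
  have [|_ kM ki0 _] := stabilizes_real_gain z0 M0 hS hQ (st M _).
    by rewrite Mmu ltW.
  suff : Q < M * (k * z - ki) by lra.
  rewrite mul1r in Sk.
  have -> : Q = M * (S * z) by rewrite /M; field; rewrite !gt_eqF.
  have Skz : S * z < k * z by rewrite ltr_pM2r.
  by rewrite ltr_pM2l //; lra.
apply/lee_subgt0Pr => e e0; apply: ereal_sup_ubound; exists (M - e) => //.
(* For this gain [al * k * z < Q] means [al < M - e], while [M - e < M] gives [S < k]. *)
exists (p_controller (Q / (z * (M - e)))).
  by apply: pX; exists (Q / (z * (M - e))).
move=> al /andP[al1 ale]; apply: stabilizes_p_controller => s hs.
have m0 : 0 < M - e by lra.
set k := Q / _ in hs.
have Q0 : 0 < Q by have := mulr_gt0 S0 z0; lra.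
have kE : k * z * (M - e) = Q by rewrite /k; field; rewrite !gt_eqF.
have k0 : 0 < k by rewrite divr_gt0 // mulr_gt0.
have Sk : S < k.
  have : (M - e) * (z * S) < M * (z * S) by rewrite ltr_pM2r //; lra.
  by rewrite divfK ?gt_eqF // /k ltr_pdivlMr ?mulr_gt0 //; lra.
have Sak : S < al * k by rewrite (lt_le_trans Sk) // ler_peMl // ltW.
have akz : al * k * z < Q.
  by rewrite -kE -mulrA mulrC ltr_pM2l // mulr_gt0.
apply: (@quadratic_hurwitz R (real_complex R (al * k - S))
  (real_complex R (Q - al * k * z))).
- by rewrite /= subr_gt0.
- by rewrite /= !mulr0 addr0 expr0n subr0 mulr_gt0 ?exprn_gt0 // subr_gt0.
- rewrite -[RHS]hs (pole_polyE _ hS hQ); ring.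
Qed.

(** The upper bound holds for every PI controller and a P controller attains it, so every class in
    between has this margin. *)
Lemma phase_marginE (R : realType) (z S Q k w0 : R) (p1 p2 : R[i])
    (X : set {fraction {poly R}}) :
  0 < z -> 0 < S -> S * z < Q ->
  p1 + p2 = real_complex R S -> p1 * p2 = real_complex R Q ->
  let E := Q - S * z in let F := z * Q in let a := S - z in
  let x0 := w0 ^+ 2 in
  0 < w0 -> x0 < E -> a * x0 ^+ 2 + (a * E + 3 * F) * x0 - E * F = 0 ->
  0 < k -> k ^+ 2 = S / z * (x0 + Q) ->
  p_type `<=` X -> X `<=` pi_type ->
  0 < atan (w0 * (E - x0) / (F + a * x0)) ->
  phase_margin (plant z p1 p2) X = atan (w0 * (E - x0) / (F + a * x0)).
Proof.
move=> z0 S0 SzQ hS hQ E F a x0 w00 x0E stat k0 kE pX Xpi.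
set tm := atan _ => tm0.
rewrite /phase_margin; set A := [set eta | _].
have Atm : A tm.
  split.
    rewrite ltW //=; have := atan_ltpi2 (w0 * (E - x0) / (F + a * x0)).
    by rewrite -/tm; have := pi_gt0 R; lra.
  exists (p_controller k); first by apply: pX; exists k.
  move=> t; rewrite -ltr_norml.
  exact: optimal_p_stabilizes z0 S0 SzQ hS hQ w00 x0E stat k0 kE.
have ubA : ubound A tm.
  move=> eta [_ [K /Xpi[kp [ki ->]] st]]; rewrite leNgt; apply/negP => lt.
  have [|t nst h] :=
      pi_phase_bound (k := kp) (ki := ki) z0 S0 SzQ hS hQ w00 x0E stat.
    by apply: st; apply/andP; split; lra.
  apply: nst; apply: st; rewrite -ltr_norml; apply: le_lt_trans lt.
  by case: h => [/ltW|[->]].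
apply/eqP; rewrite eq_le ge_sup //=; last by exists tm.
by apply: ub_le_sup => //; exists tm.
Qed.

Theorem theorem5p1 (R : realType) (z : R) (p1 p2 : R[i])
  (hz : 0 < z) (hp1 : 0 < complex.Re p1) (hp2 : 0 < complex.Re p2)
  (hp : (complex.Im p1 = 0 /\ complex.Im p2 = 0) \/ p2 = conjc p1) :
  let P := plant z p1 p2 in
  let S := pole_sum p1 p2 in
  let Q := pole_prod p1 p2 in
  ((exists2 K, pi_type K & stabilizes 1 P K) -> S < Q / z) /\
  (S < Q / z ->
    (gain_margin P pi_type = (Q / (z * S))%:E /\
     gain_margin P p_type = (Q / (z * S))%:E) /\
    (phase_margin P pi_type = theta_bar z p1 p2 (omega0 z p1 p2) /\
     phase_margin P p_type = theta_bar z p1 p2 (omega0 z p1 p2)) /\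
    (forall kp ki : R, phase_optimal_pi P kp ki <->
       kp = kp_opt z p1 p2 /\ ki = 0)).
Proof.
move=> P S Q.
have [[S0 Q0 hS hQ] [hsq hsd]] := pole_symmetric_functions hp1 hp2 hp.
rewrite -/S -/Q in S0 Q0 hS hQ hsq hsd.
split=> [[K [k [ki ->]]]|].
  rewrite -[1]/(real_complex R 1).
  move=> /(stabilizes_real_gain hz ltr01 hS hQ).
  (* [S * z < k * z <= k * z - ki < Q]. *)
  rewrite !mul1r => -[Sk kQ ki0 _].
  rewrite ltr_pdivlMr //.
  have : S * z < k * z by rewrite ltr_pM2r.
  by lra.
rewrite ltr_pdivlMr // => SzQ.
have p_sub : @p_type R `<=` pi_type.
  by move=> _ [k _ <-]; exists k, 0; rewrite p_controllerE.
split; first by split; apply: gain_marginE hQ _ _.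
pose E := Q - S * z; pose F := z * Q; pose a := S - z.
have E0 : 0 < E by rewrite subr_gt0.
have F0 : 0 < F by exact: mulr_gt0.
have FE : 0 < F + a * E.
  have -> : F + a * E = S * (E + z ^+ 2) by rewrite /F /a /E; ring.
  by rewrite mulr_gt0 // addr_gt0 // exprn_gt0.
have := stationary_freq_sqrP E0 F0 FE; rewrite -/E -/F -/a.
set w := omega0 z p1 p2; have wE : w = _ := omega0E hz S0 hsq hsd.
rewrite -/S -/Q -/E -/F -/a in wE.
move=> [/andP[x00 x0E] stat].
have w0 : 0 < w by rewrite wE sqrtr_gt0.
have ww : stationary_freq_sqr a E F = w ^+ 2 by rewrite wE sqr_sqrtr // ltW.
rewrite {}ww in x00 x0E stat.
have Sz0 : 0 < S * z by exact: mulr_gt0.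
have tE : theta_bar z p1 p2 w = atan (w * (E - w ^+ 2) / (F + a * w ^+ 2)).
  by apply: theta_barE => //; rewrite -/Q; rewrite /E in x0E; lra.
have Fax : 0 < F + a * w ^+ 2.
  have -> : F + a * w ^+ 2 = z * (E - w ^+ 2 + S * z) + S * w ^+ 2.
    by rewrite /F /a /E; ring.
  by rewrite addr_gt0 ?mulr_gt0 // ltr_pwDl ?subr_gt0 // ltW.
have tm0 : 0 < atan (w * (E - w ^+ 2) / (F + a * w ^+ 2)).
  by rewrite -(@atan0 R) lt_atan // divr_gt0 // mulr_gt0 // subr_gt0.
set k := kp_opt z p1 p2.
have kk0 : 0 < S / z * (w ^+ 2 + Q) by rewrite mulr_gt0 ?divr_gt0 // addr_gt0.
have k0 : 0 < k by rewrite sqrtr_gt0.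
have kE : k ^+ 2 = S / z * (w ^+ 2 + Q) by rewrite sqr_sqrtr // ltW.
have pm X : p_type `<=` X -> X `<=` pi_type ->
    phase_margin P X = atan (w * (E - w ^+ 2) / (F + a * w ^+ 2)).
  by move=> pX Xpi; apply: phase_marginE hQ w0 x0E stat k0 kE pX Xpi tm0.
rewrite tE; split; first by split; apply: pm.
move=> kp ki; rewrite /phase_optimal_pi pm //; split=> [st|[-> ->] t].
  (* An optimal controller tolerates every angle below the margin, so only the equality case
     remains. *)
  have [|t nst [lt|[_ ki0 Sk kY]]] :=
      pi_phase_bound (k := kp) (ki := ki) hz S0 SzQ hS hQ w0 x0E stat.
  - by apply: st; rewrite normr0.
  - by case: nst; apply: st.
  (* [S < kp] makes [kp] positive, so the crossover equation for [kp ^+ 2] determines it. *)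
  split=> //; apply/eqP; rewrite -(@eqrXn2 _ 2) //; [|lra|exact: ltW].
  have Y0 : 0 < z ^+ 2 + w ^+ 2 by rewrite addr_gt0 // exprn_gt0.
  apply/eqP/(mulIf (lt0r_neq0 Y0)).
  by rewrite kY (optimal_gain_crossing hz stat kE).
rewrite p_controllerE.
exact: optimal_p_stabilizes hz S0 SzQ hS hQ w0 x0E stat k0 kE.
Qed.
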